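(* Let $n\ge 1$. The number of signed permutations in $S^{\mathrm{B}}_n$ that globally avoid $321$ is $\binom{2n}{n}$.
   Context: Notation: $[n]=\{1,\dots,n\}$ and $[\pm n]=\{\pm1,\dots,\pm n\}$. Elements of the symmetric group $S_k$ are written in one-line notation $p(1)\cdots p(k)$. $S^{\mathrm{B}}_n$ is the set (group) of signed permutations of size $n$, i.e. bijections $w:[\pm n]\to[\pm n]$ with $w(-x)=-w(x)$ for all $x\in[n]$. Global avoidance: for $p\in S_k$, a signed permutation $w\in S^{\mathrm{B}}_n$ globally contains $p$ if there are indices $i_1<\cdots<i_k$ in $[\pm n]$ (in the usual order of the integers) such that $w(i_1)\cdots w(i_k)$ is order-isomorphic to $p$; otherwise $w$ globally avoids $p$. *)

(* Defs.v *)
From HB Require Import structures.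
From mathcomp Require Import all_boot all_order all_algebra all_fingroup.

Set Implicit Arguments.
Unset Strict Implicit.
Unset Printing Implicit Defensive.

Import Order.TTheory GRing.Theory Num.Theory.
Local Open Scope ring_scope.

(* [±n], as a finite subtype of [int]; the order is that of [int] via [val]. *)
Definition pm_seq (n : nat) : seq int :=
  [seq - (i%:Z) | i <- iota 1 n] ++ [seq i%:Z | i <- iota 1 n].

Lemma mem_pm_seq (n : nat) (x : int) :
  (x \in pm_seq n) = (x != 0) && (`|x| <= n)%N.
Proof.
rewrite mem_cat; apply/idP/idP.
  by case/orP => /mapP[i]; rewrite mem_iota add1n ltnS => /andP[i0 iN] ->;
     rewrite ?oppr_eq0 ?abszN absz_nat iN andbT; case: i i0 {iN}.
case: x => m /andP[m0 mN]; apply/orP; [right | left]; apply/mapP.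
  by exists m => //; rewrite mem_iota add1n ltnS mN andbT; case: m m0 {mN}.
by exists m.+1; rewrite ?NegzE // mem_iota add1n ltnS.
Qed.

Definition pm (n : nat) : finType := seq_sub (pm_seq n).

Lemma pm_opp_subproof (n : nat) (x : pm n) : - val x \in pm_seq n.
Proof. by rewrite mem_pm_seq oppr_eq0 abszN -mem_pm_seq; apply: valP. Qed.

Definition pm_opp (n : nat) (x : pm n) : pm n := SeqSub (pm_opp_subproof x).

Definition signed_perms (n : nat) : {set {perm pm n}} :=
  [set w : {perm pm n} |
     [forall x : pm n, (0 < val x) ==> (w (pm_opp x) == pm_opp (w x))]].

Definition globally_contains (n k : nat) (w : {perm pm n}) (p : 'S_k) : bool :=
  [exists i : {ffun 'I_k -> pm n},
     [forall a : 'I_k, forall b : 'I_k, (a < b)%N ==> (val (i a) < val (i b))]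
  && [forall a : 'I_k, forall b : 'I_k,
        (val (w (i a)) < val (w (i b))) == (p a < p b)%N]].

Definition globally_avoids (n k : nat) (w : {perm pm n}) (p : 'S_k) : bool :=
  ~~ globally_contains w p.

Definition p321 : 'S_3 := perm (@rev_ord_inj 3).

(* ['I_3] counts from 0, hence the successor in one-line notation. *)
Lemma p321_one_line : [seq (p321 a).+1 | a <- enum 'I_3] = [:: 3; 2; 1]%N.
Proof. by rewrite !enum_ordSl enum_ord0 /= !permE. Qed.

(* Main.v *)
(* A signed permutation is read through its window u = w(1) ... w(n), and a
   letter m > |x| is inserted into a window a ++ b.  In a 321-avoiding word the
   letters after the maximum and those before the minimum increase, so
   a ++ m :: b avoids 321 iff a ++ b does and b is increasing, whereas
   a ++ -m :: b does iff moreover a is empty.  Hence, if T(n, k) counts the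
   avoiding windows whose letters from the k-th on (counting from 0) increase,
   then T(n+1, k) = T(n, 0) + sum_(l <= k) T(n, l) for k <= n.  The solution is
   T(n, k) = sum_(k <= i <= n) C(n + k, i), and T(n, n) = C(2n, n) counts all
   the avoiding windows. *)
Require Import Defs.
From mathcomp Require Import all_boot all_order all_algebra all_fingroup.
From mathcomp Require Import zify.

Set Implicit Arguments.
Unset Strict Implicit.
Unset Printing Implicit Defensive.

Import Order.TTheory GRing.Theory Num.Theory.

(** * 321-avoidance of words over a totally ordered alphabet *)

Section Avoid321.
Local Open Scope order_scope.
Variables (d : Order.disp_t) (T : orderType d).
Implicit Types (s a b : seq T) (x m : T).

Notation incr := (pairwise <=%O).

(** A letter plays the 3 of a pattern exactly when the smaller letters to its right contain a strict
    descent, that is, fail to be weakly increasing. *)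
Fixpoint avoids321 s : bool :=
  if s is x :: s' then incr [seq y <- s' | y < x] && avoids321 s' else true.

(** A strict maximum can only play the 3, which it does as soon as [b] has a descent. *)
Lemma avoids321_max m a b : all (< m) (a ++ b) ->
  avoids321 (a ++ m :: b) = incr b && avoids321 (a ++ b).
Proof.
elim: a => [|x a IH] /=; first by move=> /all_filterP ->.
case/andP=> xm Hab; rewrite IH // !filter_cat /= ltNge (ltW xm) /=.
by case: (incr b); rewrite ?andbF.
Qed.

(** Dually, a strict minimum can only play the 1, after a descent in [a]. *)
Lemma avoids321_min m a b : all (> m) (a ++ b) ->
  avoids321 (a ++ m :: b) = incr a && avoids321 (a ++ b).
Proof.
elim: a => [|x a IH] /=.
  by move=> Hb; rewrite (_ : [seq _ <- b | _] = [::]) //;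
     apply/eqP; rewrite -size_eq0 size_filter -leqn0 leqNgt -has_count;
     apply/hasPn => y /(allP Hb) my; rewrite -leNgt ltW.
case/andP=> mx Hab; rewrite IH // !filter_cat /= mx.
have Hb : all (<=%O m) [seq y <- b | y < x].
  apply/allP => y; rewrite mem_filter => /andP[_ yb].
  by apply/ltW/(allP Hab); rewrite mem_cat yb orbT.
(* The letters below [x] to its right include [m]. Those in [a] precede [m] and exceed it, so there
   must be none: this is the head condition of [incr (x :: a)]. *)
have [xa|/allPn[y ya xy]] := boolP (all (<=%O x) a).
  rewrite (_ : [seq _ <- a | _] = [::]) /= ?Hb; last first.
    apply/eqP; rewrite -size_eq0 size_filter -leqn0 leqNgt -has_count.
    by apply/hasPn => y /(allP xa); rewrite leNgt.
  by rewrite andbCA.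
rewrite pairwise_cat [allrel _ _ _](_ : _ = false) //.
apply/negbTE/negP => /allrelP/(_ y m); rewrite mem_filter ltNge xy ya mem_head.
by move=> /(_ isT isT); rewrite leNgt (allP Hab) // mem_cat ya.
Qed.

Lemma incr_cat_max m a b : all (< m) b ->
  incr (a ++ m :: b) -> b = [::].
Proof.
case: b => // x b /andP[/= xm _]; rewrite pairwise_cat => /and3P[_ _] /=.
by rewrite leNgt xm.
Qed.

(* [s] lists, in increasing order, the positions of the word [map f s]. *)
Lemma incrPn (d' : Order.disp_t) (I : orderType d') (f : I -> T) (s : seq I) :
  pairwise <%O s ->
  reflect (exists x y : I, [/\ x \in s, y \in s, x < y & f y < f x])
          (~~ incr [seq f i | i <- s]).
Proof.
elim: s => [|i s IH] /=; first by constructor => -[x [y []]].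
case/andP=> /allP Hi /IH {}IH; rewrite negb_and.
apply: (iffP orP) => [[/allPn[_ /mapP[y ys ->]]|/IH[x [y [xs ys xy fyx]]]]|].
- by rewrite -ltNge => fyi; exists i, y; rewrite mem_head inE ys orbT Hi.
- by exists x, y; rewrite !inE xs ys !orbT.
case=> x [y []]; rewrite !inE => /predU1P[->|xs] /predU1P[->|ys].
- by rewrite ltxx.
- by move=> _ fyi; left; apply/allPn; exists (f y); rewrite ?map_f // -ltNge.
- by move=> /lt_trans/(_ (Hi _ xs)); rewrite ltxx.
- by move=> xy fyx; right; apply/IH; exists x, y.
Qed.

(** Links the recursive test to pattern containment: either the first position plays the 3 and
    [incrPn] finds the descent below it, or the pattern lies in the tail. *)
Lemma avoids321Pn (d' : Order.disp_t) (I : orderType d') (f : I -> T)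
    (s : seq I) : pairwise <%O s ->
  reflect (exists x y z : I, [/\ [/\ x \in s, y \in s & z \in s], x < y, y < z,
             f y < f x & f z < f y])
          (~~ avoids321 [seq f i | i <- s]).
Proof.
elim: s => [|i s IH] /=; first by constructor => -[x [y [z [[]]]]].
case/andP=> /allP Hi sS; move/IH: (sS) => {}IH; rewrite negb_and filter_map.
have Hf := incrPn f (pairwise_filter (preim f (< f i)) sS).
apply: (iffP orP) => [[/Hf|/IH]|].
- case=> y [z []]; rewrite !mem_filter /= => /andP[fyi ys] /andP[_ zs] yz fzy.
  by exists i, y, z; rewrite !inE eqxx ys zs !orbT Hi.
- case=> x [y [z [[xs ys zs] *]]].
  by exists x, y, z; rewrite !inE xs ys zs !orbT.
case=> x [y [z [[]]]]; rewrite !inE => xs ys zs xy yz fyx fzy.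
(* As [i] is the least position, only [x] can equal it. *)
have ltiF j : (j == i) || (j \in s) -> (j < i) = false.
  by case/predU1P=> [->|/Hi ij]; rewrite ?ltxx // ltNge ltW.
have {}ys : y \in s.
  by case/predU1P: ys => // yi; rewrite yi ltiF in xy.
have {}zs : z \in s.
  by case/predU1P: zs => // zi; rewrite zi ltiF ?ys ?orbT in yz.
case/predU1P: xs => [xi|xs]; [left; apply/Hf|right; apply/IH].
  by exists y, z; rewrite !mem_filter /= ys zs -xi fyx (lt_trans fzy).
by exists x, y, z.
Qed.

End Avoid321.

Local Notation incr := (pairwise <=%O).

(** * Windows and their symmetric extensions *)

Section SignedWords.
Local Open Scope ring_scope.

Definition flip (u : seq int) : seq int := rev [seq - x | x <- u].

Lemma flip_cat u v : flip (u ++ v) = flip v ++ flip u.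
Proof. by rewrite /flip map_cat rev_cat. Qed.

Lemma flip_cons x u : flip (x :: u) = rcons (flip u) (- x).
Proof. by rewrite /flip /= rev_cons. Qed.

Lemma incr_flip u : incr (flip u) = incr u.
Proof.
elim: u => //= x u IH; rewrite flip_cons pairwise_rcons IH; congr andb.
by rewrite all_rev all_map; apply: eq_all => y /=; rewrite lerN2.
Qed.

(* The word w(-n) ... w(-1) w(1) ... w(n) of a signed permutation with
   w(1) ... w(n) = u. *)
Definition full (u : seq int) : seq int := flip u ++ u.

Lemma all_lt_full (m : int) u :
  all (fun x : int => `|x| < m) u ->
  all (fun x : int => (- m < x) && (x < m)) (full u).
Proof.
move=> /allP H; apply/allP => x; rewrite mem_cat mem_rev => /orP[/mapP[y + ->]|].
  by move/H; rewrite -normrN ltr_norml.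
by move/H; rewrite ltr_norml.
Qed.

(** The full word gains the maximum [m] and the minimum [- m]. Removing them requires [incr b] and
    [incr (flip b)], which agree by symmetry. *)
Lemma avoids321_full_max (m : int) a b : 0 < m ->
  all (fun x : int => `|x| < m) (a ++ b) ->
  avoids321 (full (a ++ m :: b)) = incr b && avoids321 (full (a ++ b)).
Proof.
move=> m0 H.
have Hf : {in full (a ++ b), forall x, - m < x < m} := allP (all_lt_full H).
have -> : full (a ++ m :: b) = (flip b ++ - m :: (flip a ++ a)) ++ m :: b.
  by rewrite /full !flip_cat flip_cons cat_rcons -!catA /= -?catA.
rewrite avoids321_max; last first.
  apply/allP => x; rewrite !mem_cat inE !mem_cat => E.
  case: (eqVneq x (- m)) => [->|xm]; first by rewrite /= gtrN.
  suff /Hf/andP[] : x \in full (a ++ b) by [].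
  rewrite /full flip_cat !mem_cat.
  by move: E; rewrite (negbTE xm) /= -!orbA => /or4P[] ->; rewrite ?orbT.
have -> : full (a ++ b) = flip b ++ flip a ++ a ++ b by rewrite /full flip_cat -!catA.
rewrite -!catA cat_cons avoids321_min -?catA; last first.
  apply/allP => x xf; suff /Hf/andP[] : x \in full (a ++ b) by [].
  by rewrite /full flip_cat -!catA.
by rewrite incr_flip andbA andbb.
Qed.

(** Now [m] stands to the left of [- m], so everything after [m] must increase; a letter of [a]
    between them would exceed the later [- m]. *)
Lemma avoids321_full_min (m : int) a b : 0 < m ->
  all (fun x : int => `|x| < m) (a ++ b) ->
  avoids321 (full (a ++ - m :: b)) =
  [&& nilp a, incr b & avoids321 (full (a ++ b))].
Proof.
move=> m0 H.
have Hf : {in full (a ++ b), forall x, - m < x < m} := allP (all_lt_full H).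
have -> : full (a ++ - m :: b) = flip b ++ m :: (flip a ++ a ++ - m :: b).
  by rewrite /full !flip_cat flip_cons opprK cat_rcons -!catA.
rewrite avoids321_max; last first.
  apply/allP => x; rewrite !mem_cat inE => E.
  case: (eqVneq x (- m)) => [->|xm]; first by rewrite /= gtrN.
  suff /Hf/andP[] : x \in full (a ++ b) by [].
  rewrite /full flip_cat !mem_cat.
  by move: E; rewrite (negbTE xm) /= -!orbA => /or4P[] ->; rewrite ?orbT.
case: a H Hf => [|x a] H Hf; last first.
  rewrite [incr _](_ : _ = false) //; apply/negbTE/negP.
  rewrite pairwise_cat pairwise_cat => /and3P[_ _ /and3P[+ _ _]].
  move/allrelP/(_ x (- m)); rewrite !mem_head => /(_ isT isT).
  have /Hf/andP[+ _] : x \in full ((x :: a) ++ b) by rewrite mem_cat mem_head orbT.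
  by rewrite ltNge => /negP.
rewrite /= avoids321_min; last first.
  by apply/allP => x /Hf/andP[].
rewrite incr_flip andbA /full; congr andb.
suff -> : all (<=%O (- m)) b by rewrite andbb.
apply/allP => x xb; apply/ltW.
by suff /Hf/andP[] : x \in full b by []; rewrite mem_cat xb orbT.
Qed.

(** * Generation of the avoiding windows by insertion of the largest letter *)

Definition good_word (n : nat) (u : seq int) : bool :=
  perm_eq [seq `|x|%N | x <- u] (iota 1 n) && avoids321 (full u).

Lemma good_word_size n u : good_word n u -> size u = n.
Proof. by case/andP=> /perm_size; rewrite size_map size_iota. Qed.

Lemma abs_iota_lt n u : perm_eq [seq `|x|%N | x <- u] (iota 1 n) ->
  all (fun x : int => `|x| < n.+1%:Z) u.
Proof.
move=> E; apply/allP => x /(map_f absz); rewrite (perm_mem E) mem_iota.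
by rewrite add1n -abszE ltz_nat => /andP[].
Qed.

(** The insertions permitted by [avoids321_full_max] and [avoids321_full_min]; [- m] can only go in
    front. *)
Definition extensions (m : int) (u : seq int) : seq (seq int) :=
  [seq take k u ++ m :: drop k u | k <- iota 0 (size u).+1 & incr (drop k u)]
  ++ (if incr u then [:: - m :: u] else [::]).

Fixpoint good_words (n : nat) : seq (seq int) :=
  if n is n'.+1 then flatten [seq extensions n%:Z u | u <- good_words n']
  else [:: [::]].

Lemma extensionsP (m : int) u v :
  reflect (exists a b, [/\ u = a ++ b, incr b &
             v = a ++ m :: b \/ (nilp a /\ v = - m :: b)])
          (v \in extensions m u).
Proof.
apply: (iffP idP).
  rewrite mem_cat => /orP[/mapP[k]|].
    rewrite mem_filter => /andP[sk _] ->.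
    by exists (take k u), (drop k u); rewrite cat_take_drop; split; [|by []|left].
  case: ifP => // su; rewrite inE => /eqP ->.
  by exists [::], u; split; [|by []|right].
case=> a [b [-> sb [->|[/nilP -> ->]]]]; rewrite mem_cat; apply/orP; [left|right].
  apply/mapP; exists (size a); last by rewrite take_size_cat // drop_size_cat.
  by rewrite mem_filter drop_size_cat // sb mem_iota size_cat /= add0n ltnS leq_addr.
by rewrite /= sb mem_head.
Qed.

Lemma mem_good_words n v : (v \in good_words n) = good_word n v.
Proof.
elim: n v => [|n IH] v.
  rewrite inE /good_word; case: v => // x v; rewrite /= andbC.
  by apply/esym/negbTE; rewrite negb_and; apply/orP; right; apply/negP => /perm_size.
have n0 : 0 < n.+1%:Z :> int by [].
have Hperm a b x : `|x|%N = n.+1 ->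
    perm_eq [seq `|x|%N | x <- a ++ x :: b] (iota 1 n.+1) =
    perm_eq [seq `|x|%N | x <- a ++ b] (iota 1 n).
  move=> xn; have -> : iota 1 n.+1 = iota 1 n ++ [:: n.+1].
    by rewrite -(addn1 n) iotaD add1n addn1.
  rewrite !map_cat /= xn (perm_catCA _ [:: _]).
  by rewrite perm_sym perm_catC perm_cons perm_sym.
apply/flatten_mapP/idP => [[u]|].
  rewrite IH => /andP[pu au] /extensionsP[a [b [uE sb vE]]].
  have Hu := abs_iota_lt pu; rewrite uE in pu au Hu.
  case: vE => [->|[/nilP a0 ->]]; rewrite /good_word.
    by rewrite Hperm // pu avoids321_full_max // sb au.
  rewrite a0 in pu au Hu.
  by rewrite -[- _ :: b]cat0s Hperm ?abszN // pu avoids321_full_min // sb au.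
case/andP=> pv av.
have : n.+1 \in [seq `|x|%N | x <- v] by rewrite (perm_mem pv) mem_iota; lia.
(* Conversely, [v] is cut at its letter of absolute value [n.+1]; deleting that letter leaves the
   parent [a ++ b]. *)
case/mapP=> x /splitPr vE xn; case: vE pv av => a b; rewrite Hperm // => pv av.
have Hu := abs_iota_lt pv; exists (a ++ b); first rewrite IH /good_word pv.
  move: av; have [->|->] : x = n.+1%:Z \/ x = - n.+1%:Z by lia.
    by rewrite avoids321_full_max // => /andP[].
  by rewrite avoids321_full_min // => /and3P[].
apply/extensionsP; exists a, b; split=> //.
  move: av; have [->|->] : x = n.+1%:Z \/ x = - n.+1%:Z by lia.
    by rewrite avoids321_full_max // => /andP[].
  by rewrite avoids321_full_min // => /and3P[].
move: av; have [->|->] : x = n.+1%:Z \/ x = - n.+1%:Z by lia.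
  by left.
by rewrite avoids321_full_min // => /and3P[a0 _ _]; right; rewrite (nilP a0).
Qed.

(** The map [g] recovers the block from any of its elements, so distinct blocks are disjoint. *)
Lemma flatten_map_uniq (T U : eqType) (f : T -> seq U) (g : U -> T) s :
  uniq s -> {in s, forall x, uniq (f x)} ->
  {in s, forall x, {in f x, forall y, g y = x}} -> uniq (flatten (map f s)).
Proof.
elim: s => //= x s IH /andP[xs us] Hf Hg; rewrite cat_uniq Hf ?mem_head //=.
rewrite IH // ?andbT; last 2 first.
- by move=> y ys; apply: Hf; rewrite inE ys orbT.
- by move=> y ys; apply: Hg; rewrite inE ys orbT.
apply/hasPn => y /flatten_mapP[z zs yz]; apply/negP => yx.
have := Hg x (mem_head x s) y yx; rewrite (Hg z _ y yz) ?inE ?zs ?orbT // => zx.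
by rewrite -zx zs in xs.
Qed.

Lemma good_words_uniq n : uniq (good_words n).
Proof.
elim: n => //= n IH.
(* Deleting the letter of absolute value [n.+1] recovers the parent. *)
pose g := filter (fun x : int => `|x|%N != n.+1).
have gid u : u \in good_words n -> all (fun x : int => `|x|%N != n.+1) u.
  rewrite mem_good_words => /andP[/abs_iota_lt /allP Hu _].
  by apply/allP => x /Hu /=; lia.
apply: (flatten_map_uniq (g := g)) IH _ _ => u uG; last first.
  move=> v /extensionsP[a [b [uE _]]]; rewrite uE in uG *.
  have /all_filterP := gid _ uG; rewrite filter_cat => gE.
  case=> [->|[/nilP a0 ->]]; rewrite /g ?filter_cat /= eqxx //=.
  by rewrite a0 in gE *.
have /allP gu := gid _ uG.
have mu x : x \in u -> x != n.+1%:Z by move/gu => /=; lia.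
rewrite /extensions cat_uniq; apply/and3P; split.
- rewrite map_inj_in_uniq ?filter_uniq ?iota_uniq // => k l.
  rewrite !mem_filter !mem_iota !add0n !ltnS => /and3P[_ _ kn] /and3P[_ _ ln].
  (* The place of insertion is read off as the index of the new letter. *)
  have indx j : (j <= size u)%N ->
      index n.+1%:Z (take j u ++ n.+1%:Z :: drop j u) = j.
    move=> ju; rewrite index_cat /= eqxx addn0 size_takel // ifN //.
    by apply/negP => /mem_take /mu; rewrite eqxx.
  by move=> E; rewrite -(indx k kn) E indx.
- case: ifP => // _; apply/hasPn => y; rewrite inE => /eqP ->.
  apply/mapP => -[k _ E].
  have : n.+1%:Z \in - n.+1%:Z :: u by rewrite E mem_cat mem_head orbT.
  by rewrite inE => /orP[|/mu]; rewrite ?eqxx.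
- by case: ifP.
Qed.

(** * Counting windows by their increasing tails *)

Lemma incr_drop k (u : seq int) : incr u -> incr (drop k u).
Proof. exact/subseq_pairwise/drop_subseq. Qed.

(** Inserting [m] at a place [l < k] leaves a suffix of [drop l u] as tail; otherwise [m] is in the
    tail and must come last, which gives the term [l = k]. The summand [incr u] comes from [- m]. *)
Lemma count_extensions (m : int) u k : 0 < m ->
  all (fun x : int => `|x| < m) u -> (k <= size u)%N ->
  count (fun v => incr (drop k v)) (extensions m u) =
  (incr u + \sum_(l < k.+1) incr (drop l u))%N.
Proof.
move=> m0 Hu ku; have /allP Hm : all (< m) u.
  by apply: sub_all Hu => x /=; lia.
rewrite /extensions count_cat addnC; congr addn.
  case: ifP => //= su; rewrite addn0; case: k {ku} => [|k] /=; last by rewrite incr_drop.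
  rewrite su andbT [all _ u](_ : _ = true) //; apply/allP => x xu /=.
  by have /= := allP Hu x xu; lia.
rewrite count_map count_filter -sum1_count big_mkcond.
rewrite -[iota 0 _]/(index_iota 0 (size u).+1) big_mkord.
(* The place [l = size u] on the left is matched with the term [l = k] on the right. *)
rewrite !big_ord_recr; congr addn.
  rewrite (big_ord_widen (size u) (fun l => incr (drop l u) : nat)) //.
  rewrite [RHS]big_mkcond; apply: eq_bigr => [[l /= lu] _].
  have [lk|kl] := ltnP l k.
    rewrite drop_cat size_takel ?(ltnW lu) // ltnNge (ltnW lk) /=.
    rewrite -(prednK (n := k - l)) ?subn_gt0 //=.
    by case E: (incr (drop l u)); rewrite ?andbF ?andbT // (incr_drop _ E).
  (* For [k <= l < size u], [m] lies in the tail and is followed by a smaller letter, so nothing is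
     counted. *)
  case: ifP => // /andP[+ _]; rewrite drop_cat size_takel ?(ltnW lu) //.
  have Hd : all (< m) (drop l u) by apply/allP => x /mem_drop /Hm.
  have drop0 : drop l u <> [::].
    by move/(congr1 size); rewrite size_drop; move/eqP; rewrite subn_eq0 leqNgt lu.
  case: ltnP => [_|lk]; first by move/(incr_cat_max Hd)/drop0.
  rewrite (_ : (k - l)%N = 0%N); last by apply/eqP; rewrite subn_eq0.
  by move/(incr_cat_max (a := [::]) Hd)/drop0.
rewrite /= drop_size take_size andbT drop_cat.
case: ltnP => [_|uk].
  rewrite cats1 pairwise_rcons [all _ _](_ : _ = true); last first.
    by apply/allP => x /mem_drop /Hm /ltW.
  by case: (incr _).
have {uk ku} -> : k = size u by apply/eqP; rewrite eqn_leq ku.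
by rewrite subnn drop_size.
Qed.

(** This is T(n, k). *)
Definition incr_tails (n k : nat) : nat :=
  count (fun u => incr (drop k u)) (good_words n).

Lemma incr_tails_rec n k : (k <= n)%N ->
  incr_tails n.+1 k = (incr_tails n 0 + \sum_(l < k.+1) incr_tails n l)%N.
Proof.
move=> kn; rewrite /incr_tails /= count_flatten sumnE !big_map.
under [in RHS]eq_bigr do rewrite -sum1_count big_mkcond.
rewrite exchange_big -sum1_count [in RHS]big_mkcond -big_split.
rewrite !big_seq; apply: eq_bigr => u.
rewrite mem_good_words => uG; rewrite count_extensions ?(good_word_size uG) //.
  by rewrite drop0.
by case/andP: uG => /abs_iota_lt.
Qed.

(** Tails of at most one letter always increase. This supplies the value that [incr_tails_rec] does
    not reach. *)
Lemma incr_tails_last n : incr_tails n.+1 n.+1 = incr_tails n.+1 n.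
Proof.
apply: eq_in_count => u; rewrite mem_good_words => /good_word_size un.
rewrite drop_oversize ?un //; case: (drop n u) (size_drop n u) => //= x [] //.
by rewrite un subSnn.
Qed.

Lemma sum_binS m a b : (\sum_(a.+1 <= i < b.+1) 'C(m.+1, i) =
  \sum_(a.+1 <= i < b.+1) 'C(m, i) + \sum_(a <= i < b) 'C(m, i))%N.
Proof. by rewrite !big_add1 /= -big_split; apply: eq_bigr => i _; rewrite binS. Qed.

Lemma incr_tails_binomial n k : (k <= n)%N ->
  incr_tails n k = (\sum_(k <= i < n.+1) 'C(n + k, i))%N.
Proof.
elim: n k => [|n IHn] k; first by rewrite leqn0 => /eqP ->; rewrite big_nat1.
elim: k => [_|k IHk].
  rewrite incr_tails_rec // big_ord1 !IHn // !addn0.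
  rewrite [RHS]big_ltn // sum_binS addnA bin0; congr addn.
  by rewrite big_ltn // [in RHS]big_nat_recr //= (bin_small (ltnSn n)) addn0 bin0.
(* On the diagonal, C(2n+1, n) + C(2n+1, n+1) = C(2n+2, n+1). *)
rewrite ltnS leq_eqVlt => /predU1P[kn|kn].
  case: kn IHk => -> IHk; rewrite incr_tails_last IHk ?leqW //.
  by rewrite big_ltn // !big_nat1 addnS binS addnC.
(* The recursions at [k.+1] and [k] differ by one summand. Both terms on the right are sums of
   C(n+k+1, i), so Pascal's rule applies once the term i = n+1 is moved from one sum to the
   other. *)
have -> : incr_tails n.+1 k.+1 = (incr_tails n.+1 k + incr_tails n k.+1)%N.
  by rewrite !incr_tails_rec ?(ltnW kn) // [in LHS]big_ord_recr /= addnA.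
rewrite IHk ?IHn // 1?ltnW // ?leqW ?(ltnW kn) //.
rewrite !addSn !addnS [in RHS]sum_binS [in LHS]big_nat_recr ?leqW 1?ltnW //=.
by rewrite [in RHS]big_nat_recr ?ltnS 1?ltnW //= addnC addnA addnAC.
Qed.

Lemma size_good_words n : size (good_words n) = 'C(2 * n, n).
Proof.
have := incr_tails_binomial (leqnn n); rewrite big_nat1 mul2n -addnn => <-.
rewrite -[LHS]count_predT.
apply: eq_in_count => u; rewrite mem_good_words => /good_word_size un.
by rewrite drop_oversize ?un.
Qed.

(** * Signed permutations and their windows *)

(** Lets positions be plain integers; 0 is a dummy value outside [±n]. *)
Definition ext (n : nat) (w : {perm pm n}) (x : int) : int :=
  if insub x is Some y then val (w y) else 0.

Lemma ext_val n (w : {perm pm n}) (x : pm n) : ext w (val x) = val (w x).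
Proof. by rewrite /ext valK. Qed.

Lemma pm_oppK n : involutive (@pm_opp n).
Proof. by move=> x; apply: val_inj; rewrite /= opprK. Qed.

Lemma pm_val_neq0 n (x : pm n) : val x != 0.
Proof. by have := valP x; rewrite mem_pm_seq => /andP[]. Qed.

Lemma pm_abs_gt0 n (x : pm n) : (0 < `|val x|)%N.
Proof. by rewrite absz_gt0 pm_val_neq0. Qed.

Lemma pm_abs_le n (x : pm n) : (`|val x| <= n)%N.
Proof. by have := valP x; rewrite mem_pm_seq => /andP[]. Qed.

(** The definition tests positive [x] only; a negative [x] follows by applying it to [pm_opp x]. *)
Lemma signed_permP n (w : {perm pm n}) :
  reflect {morph w : x / pm_opp x} (w \in signed_perms n).
Proof.
rewrite inE; apply: (iffP forallP) => [H x|H x]; last first.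
  by apply/implyP => _; rewrite H.
have [x0|x0] := ltP 0 (val x); first by have /implyP/(_ x0)/eqP := H x.
have /implyP := H (pm_opp x); rewrite /= oppr_gt0 lt_neqAle pm_val_neq0 x0.
by move=> /(_ isT) /eqP; rewrite pm_oppK => ->; rewrite pm_oppK.
Qed.

(** Then [full (positions n)] lists [±n] in increasing order. *)
Definition positions (n : nat) : seq int := [seq i%:Z | i <- iota 1 n].

Lemma mem_full_positions n x : (x \in full (positions n)) = (x \in pm_seq n).
Proof. by rewrite !mem_cat mem_rev -map_comp. Qed.

Lemma full_positions_lt n : pairwise <%R (full (positions n)).
Proof.
have pos : pairwise <%R (positions n).
  rewrite pairwise_map -lt_sorted_pairwise.
  exact: sub_sorted (iota_ltn_sorted 1 n).
rewrite pairwise_cat pos andbT; apply/andP; split.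
  apply/allrelP => x y; rewrite mem_rev => /mapP[_ /mapP[i _ ->] ->] /mapP[j + ->].
  by rewrite mem_iota; lia.
rewrite -lt_sorted_pairwise rev_sorted !sorted_map.
by apply: sub_sorted (iota_ltn_sorted 1 n) => i j /= ij; rewrite ltrN2 ltz_nat.
Qed.

Definition word (n : nat) (w : {perm pm n}) : seq int :=
  [seq ext w x | x <- positions n].

Lemma full_word n (w : {perm pm n}) : w \in signed_perms n ->
  full (word w) = [seq ext w x | x <- full (positions n)].
Proof.
move/signed_permP => wS; rewrite /full /flip map_cat map_rev -!map_comp.
congr (rev _ ++ _); last by rewrite map_comp.
apply/eq_in_map => i; rewrite mem_iota => i_n /=.
have ip : i%:Z \in pm_seq n by rewrite mem_pm_seq; lia.
have := wS (SeqSub ip) => /(congr1 val) /=.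
by rewrite -!ext_val.
Qed.

Lemma avoids_word n (w : {perm pm n}) : w \in signed_perms n ->
  globally_avoids w p321 = avoids321 (full (word w)).
Proof.
move=> wS; rewrite full_word // /globally_avoids; apply: negbLR.
apply/idP/(avoids321Pn _ (full_positions_lt n)).
  case/existsP=> i /andP[/forallP H1 /forallP H2].
  have i_lt (a b : 'I_3) : (a < b)%N -> val (i a) < val (i b).
    by move=> ab; have /forallP/(_ b)/implyP := H1 a; apply.
  have w_lt (a b : 'I_3) : (b < a)%N -> val (w (i a)) < val (w (i b)).
    move=> ba; have /forallP/(_ b)/eqP -> := H2 a.
    by rewrite !permE /=; have := ltn_ord a; lia.
  exists (val (i 0)), (val (i 1)), (val (i 2)); rewrite !mem_full_positions.
  by rewrite !ext_val; split; try (apply: i_lt || apply: w_lt) => //; split; apply: valP.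
case=> x [y [z [[]]]]; rewrite !mem_full_positions => xp yp zp xy yz.
(* The occurrence sends 0, 1, 2 to [x], [y], [z]; the default of [nth] is never reached. *)
pose i := [ffun a : 'I_3 => nth (SeqSub xp) [:: SeqSub xp; SeqSub yp; SeqSub zp] a].
rewrite -[x]/(val (SeqSub xp)) -[y]/(val (SeqSub yp)) -[z]/(val (SeqSub zp)) !ext_val => wyx wzy.
apply/existsP; exists i; apply/andP; split; apply/forallP => a; apply/forallP => b.
  rewrite !ffunE; apply/implyP.
  by case: a b => [[|[|[|//]]] ?] [[|[|[|//]]] ?] //= _; lia.
have wzx := lt_trans wzy wyx; rewrite !permE !ffunE.
case: a b => [[|[|[|//]]] ?] [[|[|[|//]]] ?];
  by rewrite /= ?ltxx ?wyx ?wzy ?wzx ?(lt_gtF wyx) ?(lt_gtF wzy) ?(lt_gtF wzx).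
Qed.

Lemma word_inj n : {in signed_perms n &, injective (@word n)}.
Proof.
move=> w1 w2 w1S w2S /(congr1 full); rewrite !full_word // => /eq_in_map E.
apply/permP => x; apply: val_inj; rewrite -!ext_val; apply: E.
by rewrite mem_full_positions; apply: valP.
Qed.

Lemma word_perm n (w : {perm pm n}) : w \in signed_perms n ->
  perm_eq [seq `|x|%N | x <- word w] (iota 1 n).
Proof.
move/signed_permP=> wS.
have pos i : i \in iota 1 n -> exists2 x : pm n, val x = i%:Z & (0 < i)%N.
  rewrite mem_iota => i_n; have ip : i%:Z \in pm_seq n by rewrite mem_pm_seq; lia.
  by exists (SeqSub ip) => //; case/andP: i_n.
have uniq_w : uniq [seq `|x|%N | x <- word w].
  rewrite -!map_comp map_inj_in_uniq ?iota_uniq // => i j.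
  case/pos=> x xi i0 /pos[y yj j0] /=; rewrite -xi -yj !ext_val => E.
  (* In the second case [x] would be the opposite of [y], but both are positive. *)
  have : val (w x) = val (w y) \/ val (w x) = - val (w y) by lia.
  case=> [/val_inj/perm_inj xy|]; first by move: yj; rewrite -xy xi => -[].
  rewrite -[- _]/(val (pm_opp (w y))) -wS => /val_inj/perm_inj/(congr1 val) /=.
  by rewrite xi yj; lia.
apply: uniq_perm; rewrite ?iota_uniq //.
apply: (uniq_min_size uniq_w _ _).2; last by rewrite !size_map.
move=> _ /mapP[_ /mapP[_ /mapP[i /pos[x <- _] ->] ->] ->].
by rewrite ext_val mem_iota add1n ltnS pm_abs_gt0 pm_abs_le.
Qed.

Lemma word_surj n u : perm_eq [seq `|x|%N | x <- u] (iota 1 n) ->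
  exists2 w : {perm pm n}, w \in signed_perms n & word w = u.
Proof.
move=> pu.
have un : size u = n by have := perm_size pu; rewrite size_map size_iota.
have uu : uniq [seq `|x|%N | x <- u] by rewrite (perm_uniq pu) iota_uniq.
(* The odd extension of the window; the predecessor appears because lists are indexed from 0. *)
pose g (x : int) : int := sgz x * nth 0%R u (`|x|.-1).
have nth_u i : (i < n)%N -> (0 < `|nth 0%R u i| <= n)%N.
  move=> i_n; have : `|nth 0%R u i|%N \in iota 1 n.
    by rewrite -(perm_mem pu) map_f // mem_nth ?un.
  by rewrite mem_iota add1n ltnS.
have idx (x : pm n) : (`|val x|.-1 < n)%N.
  by have := pm_abs_gt0 x; have := pm_abs_le x; lia.
have gabs (x : pm n) : `|g (val x)|%N = `|nth 0%R u (`|val x|.-1)|%N.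
  by rewrite /g abszM absz_sg pm_val_neq0 mul1n.
have gP (x : pm n) : g (val x) \in pm_seq n.
  by rewrite mem_pm_seq -absz_gt0 gabs nth_u.
pose f (x : pm n) : pm n := SeqSub (gP x).
have f_inj : injective f.
  move=> x y /(congr1 val) /= gxy; apply: val_inj.
  have := congr1 absz gxy; rewrite !gabs -!(nth_map 0 0%N) ?un //.
  move/eqP; rewrite nth_uniq ?size_map ?un // => /eqP xy.
  have {}xy : `|val x|%N = `|val y|%N.
    by have := pm_abs_gt0 x; have := pm_abs_gt0 y; lia.
  (* Absolute values being equal, cancelling the common nonzero letter shows that the signs
     agree. *)
  move: gxy; rewrite /g xy => /mulIf sxy.
  rewrite [LHS]intEsg [RHS]intEsg xy sxy //.
  by rewrite -absz_gt0; case/andP: (nth_u _ (idx y)).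
exists (perm f_inj).
  apply/signed_permP => x; apply: val_inj.
  by rewrite !permE /= /g sgzN abszN mulNr.
apply: (@eq_from_nth _ 0); first by rewrite !size_map size_iota un.
rewrite !size_map size_iota => i i_n.
rewrite (nth_map 0) ?size_map ?size_iota // (nth_map 0%N) ?size_iota // nth_iota //.
have ip : (1 + i)%:Z \in pm_seq n by rewrite mem_pm_seq; lia.
by rewrite -[(1 + i)%:Z]/(val (SeqSub ip)) ext_val permE /= /g mul1r.
Qed.

End SignedWords.

Theorem theorem6p1 (n : nat) (hn : 1 <= n) :
  #|[set w in signed_perms n | globally_avoids w p321]| = 'C(2 * n, n).
Proof.
rewrite -size_good_words; set A := [set w in _ | _].
have A_signed : {in enum A, forall w, w \in signed_perms n}.
  by move=> w; rewrite mem_enum inE => /andP[].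
(* The windows of [A] and [good_words n] are compared as duplicate-free lists with the same
   members. *)
rewrite cardE -(size_map (@word n)); apply/perm_size/uniq_perm.
- rewrite map_inj_in_uniq ?enum_uniq // => w1 w2 /A_signed w1S /A_signed w2S.
  exact: word_inj.
- exact: good_words_uniq.
move=> u; rewrite mem_good_words; apply/mapP/andP => [[w + ->]|[/word_surj[w wS <-] au]].
  by rewrite mem_enum inE => /andP[wS]; rewrite avoids_word // word_perm.
by exists w => //; rewrite mem_enum inE wS avoids_word.
Qed.
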